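(* The operator $S := B^* A^{-1} B : X \to X^*$ is bounded and elliptic, i.e., \[ \| S u \|_{X^*} \leq c_2^S \, \| u \|_X , \qquad \langle S u , u \rangle_H \geq c_1^S \, \| u \|_X^2 \qquad \text{for all } u \in X, \] where $c_2^S = [c_2^B]^2$ and $c_1^S = [c_1^B]^2$.
   Context: All spaces are real. $X \subset H \subset X^*$ and $Y \subset H \subset Y^*$ are Gelfand triples of Hilbert spaces, where $X^*, Y^*$ are the duals of $X, Y$ with respect to $H$; $\langle \cdot,\cdot\rangle_H$ denotes the duality pairing (both for $Y^*\times Y$ and for $X^*\times X$, written in either order). $A : Y \to Y^*$ is a bounded linear operator that is self-adjoint and elliptic in $Y$, and $Y$ is equipped with the norm $\| q \|_Y := \sqrt{\langle A q, q\rangle_H}$; $Y^*$ carries the dual norm $\| f \|_{Y^*} := \sup_{0\neq q\in Y} \langle f,q\rangle_H / \| q \|_Y$, and $X^*$ carries the dual norm $\| g \|_{X^*} := \sup_{0\neq v\in X} \langle g,v\rangle_H/\| v\|_X$. $B : X \to Y^*$ is a bounded linear operator which is surjective and for which there are positive constants $c_1^B, c_2^B$ such that for all $v\in X$ \[ \| B v \|_{Y^*} \leq c_2^B \| v \|_X, \qquad \sup_{0\neq q \in Y} \frac{\langle Bv,q\rangle_H}{\| q\|_Y} \geq c_1^B \| v\|_X . \] $B^* : Y \to X^*$ is the adjoint, $\langle B^* q, v\rangle_H := \langle q, Bv\rangle_H$ for all $v\in X$, $q\in Y$. *)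

(* Defs.v *)
From HB Require Import structures.
From mathcomp Require Import all_boot all_order all_algebra.
From mathcomp Require Import sesquilinear.
From mathcomp Require Import all_classical all_reals all_analysis.
From mathcomp Require Import lra.

Set Implicit Arguments.
Unset Strict Implicit.
Unset Printing Implicit Defensive.

Import Order.TTheory GRing.Theory Num.Theory.
Import numFieldNormedType.Exports.

Local Open Scope classical_set_scope.
Local Open Scope ring_scope.

HB.mixin Record isHilbert (R : realType) V & CompleteNormedModule R V := {
  inner : {dot V for idfun} ;
  innerE : forall v : V, inner v v = `|v| ^+ 2
}.

#[short(type="hilbertType")]
HB.structure Definition Hilbert (R : realType) :=
  {V of CompleteNormedModule R V & isHilbert R V}.

Section Dual.
Context {R : realType} {V : normedModType R}.

Definition dual_pred : {pred V -> R^o} :=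
  fun f => `[< linear f /\ continuous f >].

Lemma dual_pred_submod : submod_closed dual_pred.
Proof.
split=> [|a f g /asboolP[lf cf] /asboolP[lg cg]]; apply/asboolP; split.
- by move=> k x y; rewrite /= /GRing.zero /= scaler0 addr0.
- exact: cst_continuous.
- move=> k x y; rewrite !fctE lf lg.
  by rewrite !scalerDr !scalerA (mulrC a k) addrACA.
- move=> x; rewrite /continuous_at; apply: cvgD; last exact: cg.
  by apply: cvgZl_tmp; exact: cf.
Qed.

HB.instance Definition _ :=
  GRing.isSubmodClosed.Build R (V -> R^o) dual_pred dual_pred_submod.

Record dual := Dual { dual_fun :> V -> R^o ; dual_funP : dual_fun \in dual_pred }.

HB.instance Definition _ := [isSub of dual for dual_fun].
HB.instance Definition _ := [Choice of dual by <:].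
HB.instance Definition _ := [SubChoice_isSubLmodule of dual by <:].

Lemma dual_linear (f : dual) : linear f.
Proof. by have /asboolP[] := dual_funP f. Qed.

HB.instance Definition _ (f : dual) :=
  GRing.isLinear.Build R V R^o _ f (dual_linear f).

Lemma dual_continuous (f : dual) : continuous f.
Proof. by have /asboolP[] := dual_funP f. Qed.

Lemma dualP (f g : dual) : (forall v, f v = g v) -> f = g.
Proof. by move=> fg; apply/val_inj/funext. Qed.

Lemma dual_bounded (f : dual) : exists M, forall v, `|f v| <= M * `|v|.
Proof.
pose F : {linear V -> R^o} := dual_fun f.
have /(@linear_bounded_continuous _ _ _ F)/linear_boundedP := @dual_continuous f.
by move=> /pinfty_ex_gt0[M _ fM]; exists M.
Qed.

End Dual.
Arguments dual {R} V.

Section DualNorm.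
Context {R : realType} {V : normedModType R}.
Implicit Types f g : dual V.

Definition pairing f (v : V) : R := f v.

(* N is a norm on V equivalent to the given one, so the set is bounded above.
   On the trivial space the set is empty and its sup is 0. *)
Definition dual_norm (N : V -> R) f : R :=
  sup [set pairing f v / N v | v in [set v | v != 0]].

Let nrm := dual_norm Num.norm.

Lemma dual_norm_ubound f :
  has_ubound [set pairing f v / `|v| | v in [set v | v != 0]].
Proof.
have [M fM] := dual_bounded f; exists M => _ [v v0 <-].
rewrite ler_pdivrMr ?normr_gt0//; exact: le_trans (ler_norm _) (fM v).
Qed.

Let le_pairing f v : pairing f v <= nrm f * `|v|.
Proof.
have [->|v0] := eqVneq v 0; first by rewrite /pairing linear0 normr0 mulr0.
rewrite -ler_pdivrMr ?normr_gt0//; apply: ub_le_sup; last by exists v.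
exact: dual_norm_ubound.
Qed.

Let nrm_le f M : 0 <= M -> (forall v, pairing f v <= M * `|v|) -> nrm f <= M.
Proof.
move=> M0 fM; rewrite /nrm /dual_norm; set A := (X in sup X).
have [->|A0] := eqVneq A set0; first by rewrite sup0.
apply: ge_sup; first exact/set0P.
by move=> _ [v v0 <-]; rewrite ler_pdivrMr ?normr_gt0.
Qed.

Let nrm_ge0 f : 0 <= nrm f.
Proof.
rewrite /nrm /dual_norm; set A := (X in sup X).
have [->|/set0P[_ [v v0 _]]] := eqVneq A set0; first by rewrite sup0.
have := le_pairing f v; have := le_pairing f (- v).
rewrite normrN /pairing linearN -/nrm => h1 h2.
have : 0 <= nrm f * `|v| + nrm f * `|v|.
  by rewrite (le_trans _ (lerD h1 h2))// addNr.
by rewrite -mulrDl pmulr_lge0 ?normr_gt0// -mulr2n pmulrn_lge0.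
Qed.

Let nrmD f g : nrm (f + g) <= nrm f + nrm g.
Proof.
apply: nrm_le => [|v]; first by rewrite addr_ge0.
by rewrite mulrDl lerD.
Qed.

Let nrmZ_le (a : R) f : nrm (a *: f) <= `|a| * nrm f.
Proof.
apply: nrm_le => [|v]; first by rewrite mulr_ge0.
rewrite -mulrA; have -> : pairing (a *: f) v = pairing f (a *: v).
  by rewrite /pairing linearZ.
by rewrite (le_trans (le_pairing _ _))// normrZ mulrCA.
Qed.

Let nrmZ (a : R) f : nrm (a *: f) = `|a| * nrm f.
Proof.
apply/eqP; rewrite eq_le nrmZ_le /=.
have [->|a0] := eqVneq a 0; first by rewrite normr0 mul0r nrm_ge0.
rewrite -ler_pdivlMl ?normr_gt0//.
have {1}-> : f = a^-1 *: (a *: f) by rewrite scalerA mulVf// scale1r.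
by rewrite (le_trans (nrmZ_le _ _))// normfV.
Qed.

Let nrm0_eq0 f : nrm f = 0 -> f = 0.
Proof.
move=> f0; apply: dualP => v; apply/eqP; rewrite eq_le.
have := le_pairing f v; have := le_pairing f (- v).
by rewrite f0 !mul0r /pairing linearN oppr_le0 => -> ->.
Qed.

HB.instance Definition _ :=
  Lmodule_isNormed.Build R (dual V) nrmD nrmZ nrm0_eq0.

Lemma dual_normE f : `|f| = dual_norm Num.norm f.
Proof. by []. Qed.

Lemma dual_normP f v : `|pairing f v| <= `|f| * `|v|.
Proof.
rewrite ler_norml le_pairing andbT lerNl.
by have := le_pairing f (- v); rewrite normrN /pairing linearN.
Qed.

End DualNorm.

Section Adjoint.
Context {R : realType} {V W : normedModType R}.
Variables (T : {linear V -> dual W}) (cT : continuous T).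

Lemma adjoint_subproof (w : W) :
  (fun v => pairing (T v) w : R^o) \in @dual_pred R V.
Proof.
set f := (fun v => _); apply/asboolP.
have lf : linear f by move=> k x y; rewrite /f linearP.
split=> //.
pose F : {linear V -> R^o} := HB.pack f (GRing.isLinear.Build R V R^o _ f lf).
apply: (@bounded_linear_continuous _ _ _ F); apply/linear_boundedP.
have /linear_bounded_continuous/linear_boundedP/pinfty_ex_gt0[M M0 TM] := cT.
exists (M * `|w|); split=> [|r /ltW Mr v]; first exact: num_real.
have := dual_normP (T v) w => /le_trans; apply.
apply: (le_trans (ler_wpM2r (normr_ge0 w) (TM v))).
by rewrite mulrAC ler_wpM2r.
Qed.

Definition adjoint (w : W) : dual V := Dual (adjoint_subproof w).

Lemma adjointE w v : pairing (adjoint w) v = pairing (T v) w.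
Proof. by []. Qed.

End Adjoint.

(* V is not required to be literally a subset of H: the inclusion is any
   continuous injective linear map with dense range. *)
Record gelfand_triple (R : realType) (V H : hilbertType R) := GelfandTriple {
  incl : {linear V -> H} ;
  incl_inj : injective incl ;
  incl_continuous : continuous incl ;
  incl_dense : dense (range incl)
}.

Section Pivot.
Context {R : realType} {V H : hilbertType R} (T : gelfand_triple V H).

Lemma pivot_subproof (h : H) :
  (fun v => inner h (incl T v) : R^o) \in @dual_pred R V.
Proof.
apply/asboolP; split=> [k x y|]; first by rewrite linearP linearPr.
have innerP v : inner h (incl T v) =
    2^-1 * (`|h + incl T v| ^+ 2 - `|h| ^+ 2 - `|incl T v| ^+ 2).
  rewrite -!innerE linearDl/= !linearDr/=.
  have -> : inner (incl T v) h = inner h (incl T v).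
    by rewrite hermitian_subproof expr0 mul1r.
  lra.
under eq_fun do rewrite innerP.
move=> v; apply: cvgM; first exact: cvg_cst.
have cT := @incl_continuous _ _ _ T v.
apply: cvgB; first apply: cvgB; rewrite /= ?expr2; last 1 first.
- by under eq_fun do rewrite expr2; apply: cvgM; apply: cvg_norm.
- under eq_fun do rewrite expr2.
  by apply: cvgM; apply: cvg_norm; apply: cvgD => //; exact: cvg_cst.
- exact: cvg_cst.
Qed.

(* The inclusion of H into dual V, through which pairing extends inner. *)
Definition pivot (h : H) : dual V := Dual (pivot_subproof h).

Lemma pivotE h v : pairing (pivot h) v = inner h (incl T v).
Proof. by []. Qed.

End Pivot.

Section Operators.
Context {R : realType}.

(* Y is identified with its bidual, so that the adjoint of an operator from Y
   to dual Y is again of this type. *)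
Definition self_adjoint (Y : normedModType R) (A : {linear Y -> dual Y})
    (cA : continuous A) : Prop :=
  adjoint cA = A.

Definition elliptic (Y : normedModType R) (A : Y -> dual Y) : Prop :=
  exists2 c : R, 0 < c & forall q, c * `|q| ^+ 2 <= pairing (A q) q.

Definition energy_norm (Y : normedModType R) (A : Y -> dual Y) (q : Y) : R :=
  Num.sqrt (pairing (A q) q).

(* The partial inverse 'pinv is the inverse of A, since a continuous elliptic
   operator on a Hilbert space is bijective (Lax-Milgram). *)
Definition schur (X Y : normedModType R) (A : Y -> dual Y)
    (B : {linear X -> dual Y}) (cB : continuous B) : X -> dual X :=
  adjoint cB \o 'pinv_(fun=> 0) [set: Y] A \o B.

End Operators.

(* Main.v *)
Require Import Defs.
From HB Require Import structures.
From mathcomp Require Import all_boot all_order all_algebra.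
From mathcomp Require Import sesquilinear.
From mathcomp Require Import all_classical all_reals all_analysis.
From mathcomp Require Import ring lra.

(** For [q := A^-1 (B u)] one has [<S u, v> = <B v, q>], in particular
    [<S u, u> = <A q, q>].  The Cauchy-Schwarz inequality for the inner product
    [<A ., .>] says that [A] is an isometry from [Y] with the energy norm onto
    its dual, so that [<S u, u>] is the square of the dual norm of [B u]: this
    gives ellipticity from the inf-sup condition, and boundedness from
    [<B v, q> <= |B v| |B u|].

    Surjectivity of the symmetric elliptic [A] is the Dirichlet principle: a
    minimizing sequence of [<A q, q> - 2 f q] is Cauchy by the parallelogram
    identity, and its limit solves [A q = f]. *)

Set Implicit Arguments.
Unset Strict Implicit.
Unset Printing Implicit Defensive.

Import Order.TTheory GRing.Theory Num.Theory.
Import numFieldNormedType.Exports.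

Local Open Scope classical_set_scope.
Local Open Scope ring_scope.

(** For [0 < a], evaluate at the vertex [t = - b / a]. For [a = 0], an affine function bounded below
    is constant. *)
Lemma quadratic_ge0_discriminant (R : realFieldType) (a b c : R) : 0 <= a ->
  (forall t, 0 <= a * t ^+ 2 + 2 * b * t + c) -> b ^+ 2 <= a * c.
Proof.
rewrite le_eqVlt => /predU1P[<- h|a0 h].
  have [->|b0] := eqVneq b 0; first by rewrite expr0n mul0r.
  (* The point where the affine function [2 * b * t + c] takes the value [-1]. *)
  have := h (- (c + 1) / (2 * b)).
  have -> : 0 * (- (c + 1) / (2 * b)) ^+ 2 + 2 * b * (- (c + 1) / (2 * b)) + c
    = -1 by field.
  by rewrite oppr_ge0 ler10.
have := h (- b / a).
have -> : a * (- b / a) ^+ 2 + 2 * b * (- b / a) + c = c - b ^+ 2 / a.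
  by field; rewrite gt_eqF.
by rewrite subr_ge0 ler_pdivrMr// mulrC.
Qed.

Lemma dual_norm_le (R : realType) (V : normedModType R) (N : V -> R)
    (f : dual V) (M : R) : 0 <= M -> (forall v, 0 <= N v) ->
  (forall v, pairing f v <= M * N v) -> dual_norm N f <= M.
Proof.
move=> M0 N0 fM; rewrite /dual_norm; set E := (X in sup X).
have [->|E0] := eqVneq E set0; first by rewrite sup0.
apply: ge_sup; first exact/set0P.
move=> _ [v v0 <-]; have := N0 v.
(* Where [N v = 0] the quotient is [0], by the convention [0^-1 = 0]. *)
rewrite (le_eqVlt 0) => /predU1P[<-|Nv]; first by rewrite invr0 mulr0.
by rewrite ler_pdivrMr.
Qed.

Lemma pairingDZ (R : realType) (V : normedModType R) (f : dual V) v w t :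
  pairing f (v + t *: w) = pairing f v + t * pairing f w.
Proof. by rewrite /pairing linearD linearZ. Qed.

Lemma linear_pairingDZ (R : realType) (V W : normedModType R)
    (T : {linear V -> dual W}) v w t p :
  pairing (T (v + t *: w)) p = pairing (T v) p + t * pairing (T w) p.
Proof. by rewrite linearD linearZ. Qed.

Lemma self_adjoint_pairingC (R : realType) (Y : normedModType R)
    (A : {linear Y -> dual Y}) (cA : continuous A) (A_sa : self_adjoint cA) q p :
  pairing (A q) p = pairing (A p) q.
Proof. by rewrite -{1}A_sa. Qed.

Section EllipticOperator.
Context {R : realType} {Y : normedModType R} (A : {linear Y -> dual Y}).
Context (cA : continuous A) (A_sa : self_adjoint cA) (A_ell : elliptic A).

Let a (q p : Y) : R := pairing (A q) p.

Let a_gt0 q : q != 0 -> 0 < a q q.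
Proof.
have [c c0 cq] := A_ell => q0; apply: lt_le_trans (cq q).
by rewrite mulr_gt0// exprn_gt0// normr_gt0.
Qed.

Let a_ge0 q : 0 <= a q q.
Proof.
have [c c0 cq] := A_ell; apply: le_trans (cq q).
by rewrite mulr_ge0 ?(ltW c0)// exprn_ge0.
Qed.

Lemma energy_normE q : energy_norm A q ^+ 2 = pairing (A q) q.
Proof. by rewrite sqr_sqrtr// a_ge0. Qed.

Lemma energy_norm_gt0 q : q != 0 -> 0 < energy_norm A q.
Proof. by move=> /a_gt0 aq; rewrite sqrtr_gt0. Qed.

(** Discriminant of the nonnegative quadratic [t |-> a (q + t *: p) (q + t *: p)], whose two cross
    terms agree by symmetry. *)
Lemma energy_norm_cauchy_schwarz q p :
  pairing (A q) p <= energy_norm A q * energy_norm A p.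
Proof.
rewrite -sqrtrM ?a_ge0// (le_trans (ler_norm _))// -sqrtr_sqr ler_wsqrtr//.
rewrite [leRHS]mulrC; apply: quadratic_ge0_discriminant => [|t]; first exact: a_ge0.
have := a_ge0 (q + t *: p); rewrite /a !(linear_pairingDZ, pairingDZ).
rewrite (self_adjoint_pairingC A_sa p q); congr (_ <= _); ring.
Qed.

Lemma energy_dual_norm_ubound q :
  has_ubound [set pairing (A q) p / energy_norm A p | p in [set p | p != 0]].
Proof.
exists (energy_norm A q) => _ [p p0 <-].
by rewrite ler_pdivrMr ?energy_norm_gt0// energy_norm_cauchy_schwarz.
Qed.

(** Cauchy-Schwarz bounds the supremum, and the quotient at [p = q] attains the bound. *)
Lemma energy_dual_norm q : dual_norm (energy_norm A) (A q) = energy_norm A q.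
Proof.
apply/eqP; rewrite eq_le dual_norm_le ?sqrtr_ge0//=; last 2 first.
- by move=> v; rewrite sqrtr_ge0.
- exact: energy_norm_cauchy_schwarz.
(* For [q = 0] the test vector [q] is excluded: the set of quotients is [{0}], or empty if [Y] is
   trivial. *)
have [->|q0] := eqVneq q 0.
  rewrite /energy_norm {1}/pairing linear0 sqrtr0.
  rewrite /dual_norm; set E := (X in sup X).
  have [->|/set0P[_ [v v0 _]]] := eqVneq E set0; first by rewrite sup0.
  apply: ub_le_sup; first exact: energy_dual_norm_ubound.
  by exists v => //; rewrite /pairing linear0 mul0r.
apply: ub_le_sup; first exact: energy_dual_norm_ubound.
by exists q => //; rewrite -energy_normE expr2 mulfK// gt_eqF ?energy_norm_gt0.
Qed.

End EllipticOperator.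

Section DirichletPrinciple.
Context {R : realType} {Y : completeNormedModType R} (A : {linear Y -> dual Y}).
Context (cA : continuous A) (A_sa : self_adjoint cA) (A_ell : elliptic A).

Let a (q p : Y) : R := pairing (A q) p.

Context (f : dual Y).

Let J q : R := a q q - 2 * pairing f q.

Let m := inf (range J).

Let J_has_lbound : has_lbound (range J).
Proof.
have [c c0 cq] := A_ell; exists (- (`|f| ^+ 2 / c)) => _ [q _ <-].
have h := cq q; have /ler_normlP[_ fq] := dual_normP f q.
(* Completing the square in the lower bound [c * |q|^2 - 2 * |f| * |q|] of [J q]. *)
have : 0 <= c * (`|q| - `|f| / c) ^+ 2 by rewrite mulr_ge0 ?sqr_ge0// ltW.
have -> : c * (`|q| - `|f| / c) ^+ 2 =
    c * `|q| ^+ 2 - 2 * (`|f| * `|q|) + `|f| ^+ 2 / c.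
  by field; rewrite gt_eqF.
rewrite /J /a; lra.
Qed.

Let m_le q : m <= J q.
Proof. by apply: ge_inf; [exact: J_has_lbound|exists q]. Qed.

(** Discriminant of [t |-> J (q + t *: v) - m]. Almost minimizing [J] thus means almost solving the
    equation, so the limit below is tested in the equation directly, not shown to minimize [J]. *)
Let J_residual q v : (a q v - pairing f v) ^+ 2 <= a v v * (J q - m).
Proof.
have [c c0 cq] := A_ell.
apply: quadratic_ge0_discriminant => [|t].
  by apply: le_trans (cq v); rewrite mulr_ge0 ?sqr_ge0// ltW.
have := m_le (q + t *: v).
rewrite -subr_ge0 /J /a !(linear_pairingDZ, pairingDZ).
by rewrite (self_adjoint_pairingC A_sa v q); congr (_ <= _); ring.
Qed.

Let J_parallelogram q p : a (q - p) (q - p) <= 2 * (J q + J p - 2 * m).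
Proof.
have subE (x y : Y) : x - y = x + (-1) *: y by rewrite scaleN1r.
(* The midpoint of [q] and [p]. *)
have := m_le (q + 2^-1 *: (p - q)).
rewrite !subE /J /a !(linear_pairingDZ, pairingDZ).
rewrite (self_adjoint_pairingC A_sa p q); lra.
Qed.

Lemma elliptic_solution : exists q, A q = f.
Proof.
have [c c0 cq] := A_ell.
have J_inf : has_inf (range J) by split; [exists (J 0); exists 0|].
have /choice[u uJ] : forall n : nat, exists q, J q < m + harmonic n.
  move=> n; have [_ [q _ <-] qJ] := inf_adherent (harmonic_gt0 n) J_inf.
  by exists q.
have u_cauchy : cauchy_ex (u @ \oo).
  move=> e e0.
  (* If both excesses [J (u n) - m] and [J (u N) - m] are below this number, [J_parallelogram]
     bounds the energy of the difference by [c * e ^+ 2]. *)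
  have d0 : 0 < c * e ^+ 2 / 4 by rewrite divr_gt0// mulr_gt0// exprn_gt0.
  have /cvgrPdist_lt/(_ _ d0)[N _ hN] := @cvg_harmonic R.
  have {}hN n : (N <= n)%N -> harmonic n < c * e ^+ 2 / 4.
    by move=> /hN; rewrite /= sub0r normrN ger0_norm ?ltW// harmonic_gt0.
  exists (u N); exists N => // n /= Nn.
  rewrite -ball_normE /ball_ /= -(@ltr_pXn2r _ 2)// ?nnegrE ?(ltW e0)//.
  rewrite -(ltr_pM2l c0).
  apply: le_lt_trans (cq _) _.
  have := J_parallelogram (u N) (u n); rewrite /a.
  have := uJ n; have := uJ N; have := hN _ Nn; have := hN _ (leqnn N).
  lra.
have /cvg_ex[l ul] : cvg (u @ \oo) by apply: cauchy_cvg; exact: cauchy_exP.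
exists l; apply: dualP => v; apply/eqP; rewrite -subr_eq0 -sqrf_eq0.
set F := fun n => (a (u n) v - pairing f v) ^+ 2.
have F_cvg : F n @[n --> \oo] --> (A l v - f v) ^+ 2.
  have au : a (u n) v @[n --> \oo] --> a l v.
    (* Symmetry turns [a (u n) v] into the fixed continuous functional [A v] at [u n]. *)
    rewrite /a (self_adjoint_pairingC A_sa).
    under eq_fun do rewrite (self_adjoint_pairingC A_sa).
    by apply: continuous_cvg ul; exact: dual_continuous.
  have h : a (u n) v - pairing f v @[n --> \oo] --> a l v - pairing f v.
    by apply: cvgB => //; exact: cvg_cst.
  exact: (cvgM h h).
have F0 : F n @[n --> \oo] --> 0.
  apply: (@squeeze_cvgr _ _ _ _ (fun=> 0) (fun n => a v v * harmonic n)).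
  - apply: nearW => n; rewrite sqr_ge0/= (le_trans (J_residual _ _))//.
    rewrite ler_wpM2l//; last by rewrite lerBlDl ltW.
    by apply: le_trans (cq v); rewrite mulr_ge0 ?sqr_ge0// ltW.
  - exact: cvg_cst.
  - by rewrite -[X in _ --> X](mulr0 (a v v)); exact: (cvgMl_tmp (a:=a v v) cvg_harmonic).
by apply/eqP; exact: (cvg_unique _ F_cvg F0).
Qed.

(** A partial inverse is a right inverse on the range, which is everything by
    [elliptic_solution]. *)
Lemma elliptic_pinvK : A ('pinv_(fun=> 0) [set: Y] A f) = f.
Proof.
by apply: pinvK; rewrite inE; have [q qf] := elliptic_solution; exists q.
Qed.

End DirichletPrinciple.

Theorem lemma2p2 (R : realType) (X Y H : hilbertType R)
  (TX : gelfand_triple X H) (TY : gelfand_triple Y H)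
  (A : {linear Y -> dual Y}) (cA : continuous A)
  (A_sa : self_adjoint cA) (A_ell : elliptic A)
  (B : {linear X -> dual Y}) (cB : continuous B)
  (B_surj : set_surj [set: X] [set: dual Y] B)
  (c1B c2B : R) (c1B_gt0 : 0 < c1B) (c2B_gt0 : 0 < c2B)
  (B_le : forall v : X, dual_norm (energy_norm A) (B v) <= c2B * `|v|)
  (B_infsup : forall v : X,
     c1B * `|v| <=
     sup [set pairing (B v) q / energy_norm A q | q in [set q : Y | q != 0]]) :
  (forall u : X, `|schur A cB u| <= c2B ^+ 2 * `|u|) /\
  (forall u : X, c1B ^+ 2 * `|u| ^+ 2 <= pairing (schur A cB u) u).
Proof.
set E := energy_norm A; set q := fun u : X => 'pinv_(fun=> 0) [set: Y] A (B u).
have Aq u : A (q u) = B u by exact: elliptic_pinvK.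
have E_B u : E (q u) = dual_norm E (B u).
  by rewrite -Aq (energy_dual_norm A_sa A_ell).
have S_E u v : pairing (schur A cB u) v <= E (q v) * E (q u).
  by rewrite adjointE -Aq (energy_norm_cauchy_schwarz A_sa A_ell).
have E_ge0 u : 0 <= E u by exact: sqrtr_ge0.
split=> u.
  have Eu := B_le u; rewrite dual_normE; apply: dual_norm_le => //.
    by rewrite mulr_ge0// sqr_ge0.
  move=> v; apply: le_trans (S_E u v) _.
  have -> : c2B ^+ 2 * `|u| * `|v| = (c2B * `|v|) * (c2B * `|u|) by ring.
  by rewrite ler_pM// E_B.
have -> : pairing (schur A cB u) u = E (q u) ^+ 2.
  by rewrite (energy_normE A_ell) Aq.
rewrite -exprMn ler_pXn2r// ?nnegrE ?mulr_ge0// ?(ltW c1B_gt0)//.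
(* The supremum in [B_infsup] is [dual_norm E (B u)] by definition. *)
by rewrite E_B; exact: B_infsup.
Qed.
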